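(* Let $\mathbb{F}$ be a field of characteristic zero, let $W(2)$ be the 8-dimensional $\mathbb{F}$-algebra with basis $e_1,\dots,e_8$ defined in the context, and let $Ann_l(W(2))$ be the linear span of the elements $e_4,\ e_5-2e_1-3e_8,\ e_3+e_6,\ e_3+e_7$. If $I$ is a non-trivial right ideal of $W(2)$, then $I$ is a subspace of $Ann_l(W(2))$.
   Context: Let $V_2$ be a 2-dimensional vector space over $\mathbb{F}$ with basis $v_1,v_2$. $W(2)$ is the vector space of all bilinear maps $V_2\times V_2\to V_2$ with the (not necessarily associative, not necessarily unital) product $$(A\cdot B)(x,y)=A(v_1,B(x,y))-B(A(v_1,x),y)-B(x,A(v_1,y)),\qquad x,y\in V_2.$$ For $i,j,k\in\{1,2\}$ let $\alpha_{ij}^k\in W(2)$ be given by $\alpha_{ij}^k(v_t,v_l)=\delta_{it}\delta_{jl}v_k$. The basis $e_1,\dots,e_8$ of $W(2)$ is $e_1=\alpha_{11}^1-\alpha_{12}^2-\alpha_{21}^2$, $e_2=\alpha_{11}^2$, $e_3=\alpha_{22}^2-\alpha_{12}^1-\alpha_{21}^1$, $e_4=\alpha_{22}^1$, $e_5=2\alpha_{11}^1+\alpha_{12}^2+\alpha_{21}^2$, $e_6=2\alpha_{22}^2+\alpha_{12}^1+\alpha_{21}^1$, $e_7=\alpha_{12}^1-\alpha_{21}^1$, $e_8=\alpha_{12}^2-\alpha_{21}^2$. A right ideal of an algebra $W$ is a subspace $I$ with $IW\subseteq I$; it is non-trivial if $I\neq 0$ and $I\neq W$. *)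

(* Defs.v *)
From HB Require Import structures.
From mathcomp Require Import all_boot all_order all_algebra ring.

Set Implicit Arguments.
Unset Strict Implicit.
Unset Printing Implicit Defensive.

Import GRing.Theory.
Local Open Scope ring_scope.

(* Bilinear maps V x V -> V in curried form: (A x) y is A(x, y). *)
Notation bilin V := ('Hom(V, 'Hom(V, V))).

Section BilinOf.
Variables (F : fieldType) (V : vectType F).

(* Meaningful only when f is bilinear (see bilin_ofE). *)
Definition bilin_of (f : V -> V -> V) : bilin V :=
  linfun (fun x => linfun (f x)).

Lemma bilin_ofE (f : V -> V -> V) :
    (forall x, linear (f x)) -> (forall y, linear (f^~ y)) ->
  forall x y, bilin_of f x y = f x y.
Proof.
move=> fr fl x y.
pose frL x0 := GRing.isLinear.Build F V V *:%R (f x0) (fr x0).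
pose frH x0 : {linear V -> V} := HB.pack (f x0) (frL x0).
have frE x0 z : linfun (f x0) z = f x0 z by exact: (lfunE (frH x0)).
have gl : linear (fun x0 => linfun (f x0)).
  by move=> a u w; apply/lfunP => z; rewrite !lfun_simp !frE; apply: fl.
pose glL := GRing.isLinear.Build F V 'Hom(V, V) *:%R (fun x0 => linfun (f x0)) gl.
pose glH : {linear V -> 'Hom(V, V)} := HB.pack (fun x0 => linfun (f x0)) glL.
by rewrite /bilin_of (lfunE glH) /= frE.
Qed.

End BilinOf.

(* The coordinates of a_1 e_1 + ... + a_8 e_8 determine the a_i. *)
Lemma w2_coefs (F : fieldType) (a1 a2 a3 a4 a5 a6 a7 a8 : F) :
    (2%:R : F) != 0 -> (3%:R : F) != 0 ->
    [/\ a1 + a5 * 2 = 0, - a1 + (a5 + a8) = 0 & - a1 + (a5 - a8) = 0] ->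
    [/\ a3 + a6 * 2 = 0, - a3 + (a6 + a7) = 0 & - a3 + (a6 - a7) = 0] ->
    a2 = 0 -> a4 = 0 ->
  forall i : nat, [:: a1; a2; a3; a4; a5; a6; a7; a8]`_i = 0.
Proof.
move=> n2 n3; suff sol (a b c : F) :
    [/\ a + b * 2 = 0, - a + (b + c) = 0 & - a + (b - c) = 0] ->
    [/\ a = 0, b = 0 & c = 0].
  by move=> /sol[-> -> ->] /sol[-> -> ->] -> ->; do 9?case=> //.
case=> E1 E2 E3.
have c0 : c = 0.
  apply: (mulfI n2); rewrite mulr0.
  transitivity (- a + (b + c) - (- a + (b - c))); first by ring.
  by rewrite E2 E3 subr0.
have b0 : b = 0.
  apply: (mulfI n3); rewrite mulr0.
  transitivity (a + b * 2 + (- a + (b + c)) - c); first by ring.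
  by rewrite E1 E2 c0 subr0 addr0.
by split=> //; move: E1; rewrite b0 mul0r addr0.
Qed.

Section W2.
Variables (F : fieldType) (V : vectType F) (v : 2.-tuple V).

(* The indices 1, 2 are 0, 1 : 'I_2 here; in particular v_1 is tnth v 0. *)
Definition w2mul (A B : bilin V) : bilin V :=
  bilin_of (fun x y => A (tnth v 0) (B x y) - B (A (tnth v 0) x) y
                       - B x (A (tnth v 0) y)).

Lemma w2mulE A B x y :
  w2mul A B x y =
  A (tnth v 0) (B x y) - B (A (tnth v 0) x) y - B x (A (tnth v 0) y).
Proof.
have ac (a : F) (p q r p' q' r' : V) :
    a *: p + p' - (a *: q + q') - (a *: r + r') =
    a *: (p - q - r) + (p' - q' - r').
  by rewrite !scalerBr !opprD (addrACA (a *: p)) [LHS]addrACA.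
have lP (W : vectType F) (f : 'Hom(V, W)) (a : F) (u w : V) :
    f (a *: u + w) = a *: f u + f w by exact: linearP.
rewrite /w2mul bilin_ofE // => {x y} [x a u w|y a u w].
  by rewrite /= !lP ac.
by rewrite /= !(lP, add_lfunE, scale_lfunE) ac.
Qed.

Definition alpha (i j k : 'I_2) : bilin V :=
  bilin_of (fun x y => (coord v i x * coord v j y) *: tnth v k).

Lemma alphaE i j k t l : basis_of fullv v ->
  alpha i j k (tnth v t) (tnth v l) = ((i == t) && (j == l))%:R *: tnth v k.
Proof.
move=> /andP[_ fv]; rewrite /alpha bilin_ofE.
- by rewrite !(tnth_nth 0) !coord_free // -natrM mulnb (eq_sym i) (eq_sym j).
- by move=> x a u w; rewrite linearP /= mulrDr mulrCA scalerDl scalerA.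
- by move=> y a u w; rewrite linearP /= mulrDl -mulrA scalerDl scalerA.
Qed.

Definition e1 : bilin V := alpha 0 0 0 - alpha 0 1 1 - alpha 1 0 1.
Definition e2 : bilin V := alpha 0 0 1.
Definition e3 : bilin V := alpha 1 1 1 - alpha 0 1 0 - alpha 1 0 0.
Definition e4 : bilin V := alpha 1 1 0.
Definition e5 : bilin V := 2 *: alpha 0 0 0 + alpha 0 1 1 + alpha 1 0 1.
Definition e6 : bilin V := 2 *: alpha 1 1 1 + alpha 0 1 0 + alpha 1 0 0.
Definition e7 : bilin V := alpha 0 1 0 - alpha 1 0 0.
Definition e8 : bilin V := alpha 0 1 1 - alpha 1 0 1.

Lemma w2_basis : [pchar F] =i pred0 -> basis_of fullv v ->
  basis_of fullv [:: e1; e2; e3; e4; e5; e6; e7; e8].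
Proof.
move=> /pcharf0P charF0 vb; have /andP[_ fv] := vb.
have n2 : (2%:R : F) != 0 by rewrite charF0.
have n3 : (3%:R : F) != 0 by rewrite charF0.
have dV : dim V = 2 by rewrite -dimvf (size_basis vb).
have dW : dim (bilin V) = 8.
  by rewrite -[LHS]/(dim V * (dim V * dim V))%N dV.
rewrite basisEfree subvf dimvf dW leqnn !andbT.
apply/(@freeP _ _ 8 [tuple e1; e2; e3; e4; e5; e6; e7; e8]) => k.
do 8?[rewrite big_ord_recl]; rewrite big_ord0 /= addr0.
pose c t l s (A : bilin V) := coord v s (A (tnth v t) (tnth v l)).
have cD t l s A B : c t l s (A + B) = c t l s A + c t l s B.
  by rewrite /c !add_lfunE linearD.
have cN t l s A : c t l s (- A) = - c t l s A.
  by rewrite /c !opp_lfunE linearN.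
have cZ t l s a A : c t l s (a *: A) = a * c t l s A.
  by rewrite /c !scale_lfunE linearZ.
have c0 t l s : c t l s 0 = 0 by rewrite /c !zero_lfunE linear0.
have cA t l s i j m : c t l s (alpha i j m) = ([&& i == t, j == l & m == s])%:R.
  by rewrite /c alphaE // linearZ /= (tnth_nth 0) coord_free // -natrM mulnb andbA.
move=> H.
have E t l s := congr1 (c t l s) H.
have := (E 0 0 0, (E 0 1 1, E 1 0 1), (E 1 1 1, (E 0 1 0, E 1 0 0)), (E 0 0 1, E 1 1 0)).
rewrite /e1 /e2 /e3 /e4 /e5 /e6 /e7 /e8 !(cD, cN, cZ, cA, c0) /=.
rewrite !(mulr0, mulr1, subr0, sub0r, addr0, add0r, oppr0, mulrN1).
case=> [[[E1 [E2 E3]] [E4 [E5 E6]]] [E7 E8]] i.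
have := w2_coefs n2 n3 (And3 E1 E2 E3) (And3 E4 E5 E6) E7 E8 i.
by case: i; do 8?[case=> [|]] => // lti <-; congr (k _); apply: val_inj.
Qed.

Definition Ann_l : {vspace bilin V} :=
  <<[:: e4; e5 - 2 *: e1 - 3 *: e8; e3 + e6; e3 + e7]%R>>%VS.

Definition right_ideal (I : {vspace bilin V}) : Prop :=
  forall A B : bilin V, A \in I -> w2mul A B \in I.

Definition nontrivial (I : {vspace bilin V}) : Prop :=
  I <> 0%VS /\ I <> fullv.

End W2.

(* Main.v *)
(* The product A . B depends on A only through the endomorphism a = A(v1, -),
   and Ann_l(W(2)) is the set of A with a = 0.  If A(v1, v1) = u <> 0, then
   B(x, y) = phi(x) y with phi(u) = -1 gives (A . B)(v1, -) = id, and an element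
   C with C(v1, -) = id satisfies C . B = -B, so the right ideal generated by A
   is everything.  If A(v1, v1) = 0 but A(v1, w) <> 0, then
   B(x, y) = phi(x) phi(y) w with phi(v1) = 1 gives (A . B)(v1, v1) = A(v1, w) <> 0. *)
Require Import Defs.
From HB Require Import structures.
From mathcomp Require Import all_boot all_order all_algebra ring.

Set Implicit Arguments.
Unset Strict Implicit.
Unset Printing Implicit Defensive.

Import GRing.Theory.
Local Open Scope ring_scope.

(** A nonzero vector alone is a free family, and its coordinate form is defined on all of [V]. *)
Lemma exists_form_eq1 (F : fieldType) (V : vectType F) (u : V) : u != 0 ->
  exists2 phi : V -> F, scalar phi & phi u = 1.
Proof.
move=> u0; exists (coord [tuple u] 0); first exact: linearP.
by have := coord_free 0 0 (_ : free [tuple u]); rewrite seq1_free => ->.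
Qed.

Section RightIdeals.
Variables (F : fieldType) (V : vectType F) (v : 2.-tuple V).
Implicit Types (A B : bilin V) (I : {vspace bilin V}).

Lemma right_ideal_full I A : right_ideal v I -> A \in I ->
  A (tnth v 0) (tnth v 0) != 0 -> I = fullv.
Proof.
move=> Iideal AI /exists_form_eq1[phi phiP phi1].
pose B := bilin_of (fun x y => - phi x *: y).
have BE x y : B x y = - phi x *: y.
  rewrite bilin_ofE // => {x y} [x a u w|y a u w].
    by rewrite scalerDr !scalerA mulrC.
  by rewrite phiP opprD scalerDl scalerA mulrN.
pose C := w2mul v A B.
(* The product expands to -phi(v1) A(v1, y) + phi(A(v1, v1)) y + phi(v1) A(v1, y): the outer terms
   cancel whatever phi(v1) is. *)
have CE y : C (tnth v 0) y = y.
  rewrite /C w2mulE !BE phi1 linearZ /= scaleN1r opprK.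
  by rewrite addrAC subrr add0r.
apply/vspaceP => D; rewrite memvf.
have -> : D = - w2mul v C D.
  apply/lfunP => x; apply/lfunP => y.
  by rewrite !opp_lfunE w2mulE !CE subrr sub0r opprK.
by rewrite memvN; apply/Iideal/Iideal.
Qed.

Lemma proper_right_ideal_ann I A : tnth v 0 != 0 -> right_ideal v I ->
  I != fullv -> A \in I -> A (tnth v 0) = 0.
Proof.
move=> /exists_form_eq1[phi phiP phi1] Iideal /eqP Inf AI.
have diag0 B : B \in I -> B (tnth v 0) (tnth v 0) = 0.
  move=> BI; have [//|Bvv] := eqVneq (B (tnth v 0) (tnth v 0)) 0.
  by case: Inf; apply: right_ideal_full BI Bvv.
have phi0 : phi 0 = 0.
  by have := phiP (-1) 0 0; rewrite scaler0 addr0 mulN1r addNr.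
apply/lfunP => w; rewrite zero_lfunE.
pose B := bilin_of (fun x y : V => (phi x * phi y) *: w).
have BE x y : B x y = (phi x * phi y) *: w.
  rewrite bilin_ofE // => {x y} [x a u z|y a u z].
    by rewrite phiP mulrDr mulrCA scalerDl scalerA.
  by rewrite phiP mulrDl -mulrA scalerDl scalerA.
(* The value of A . B at (v1, v1) vanishes. Since A(v1, v1) = 0, both subtracted terms carry the
   factor [phi 0], so only A(v1, w) remains. *)
have := diag0 _ (Iideal _ B AI).
rewrite w2mulE !BE diag0 // phi0 phi1 mul0r mulr0 scale0r !subr0 mulr1.
by rewrite scale1r.
Qed.

(** Turns linear identities between the [alpha]s into scalar identities within reach of [ring]. *)
Lemma bilin_coord_inj A B : basis_of fullv v ->
  (forall x y i, coord v i (A x y) = coord v i (B x y)) -> A = B.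
Proof.
move=> vb AB; apply/lfunP => x; apply/lfunP => y.
rewrite (coord_basis vb (memvf (A x y))) (coord_basis vb (memvf (B x y))).
by apply: eq_bigr => i _; rewrite AB.
Qed.

Lemma lfun_basis_inj (U : vectType F) (f g : 'Hom(V, U)) :
  basis_of fullv v -> (forall i, f (tnth v i) = g (tnth v i)) -> f = g.
Proof.
move=> vb fg; apply/lfunP => x.
rewrite (coord_basis vb (memvf x)) !linear_sum; apply: eq_bigr => i _.
by rewrite !linearZ /= -tnth_nth fg.
Qed.

(** Such an A is a combination of the four maps [alpha v 1 j k]. These come from the generators
    through e3 + e6 = 3 alpha_22^2, e3 + e7 = alpha_22^2 - 2 alpha_21^1 and e5 - 2 e1 - 3 e8 = 6
    alpha_21^2, whence the division by 2, 3 and 6. *)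
Lemma mem_Ann_l A : [pchar F] =i pred0 -> basis_of fullv v ->
  A (tnth v 0) = 0 -> A \in Ann_l v.
Proof.
move=> /pcharf0P charF0 vb A0.
have n2 : (2%:R : F) != 0 by rewrite charF0.
have n3 : (3%:R : F) != 0 by rewrite charF0.
have n6 : (6%:R : F) != 0 by rewrite charF0.
have genP B : B \in [:: e4 v; e5 v - 2 *: e1 v - 3 *: e8 v; e3 v + e6 v;
    e3 v + e7 v] -> B \in Ann_l v by exact: memv_span.
have a110 : alpha v 1 1 0 \in Ann_l v by apply: genP; rewrite mem_head.
have a111 : alpha v 1 1 1 \in Ann_l v.
  have -> : alpha v 1 1 1 = 3^-1 *: (e3 v + e6 v).
    apply: (canRL (scalerK n3)); apply: bilin_coord_inj => // x y i.
    by rewrite /e3 /e6 !lfun_simp !(linearD, linearN, linearZ) /=; ring.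
  by rewrite memvZ // genP // !inE eqxx !orbT.
have a100 : alpha v 1 0 0 \in Ann_l v.
  have -> : alpha v 1 0 0 = 2^-1 *: (alpha v 1 1 1 - (e3 v + e7 v)).
    apply: (canRL (scalerK n2)); apply: bilin_coord_inj => // x y i.
    by rewrite /e3 /e7 !lfun_simp !(linearD, linearN, linearZ) /=; ring.
  by rewrite memvZ // memvB // genP // !inE eqxx !orbT.
have a101 : alpha v 1 0 1 \in Ann_l v.
  have -> : alpha v 1 0 1 = 6^-1 *: (e5 v - 2 *: e1 v - 3 *: e8 v).
    apply: (canRL (scalerK n6)); apply: bilin_coord_inj => // x y i.
    by rewrite /e5 /e1 /e8 !lfun_simp !(linearD, linearN, linearZ) /=; ring.
  by rewrite memvZ // genP // !inE eqxx !orbT.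
have ord2P (i : 'I_2) : i = 0 \/ i = 1.
  by case: i => [[|[|?]] ?] //; [left|right]; apply: val_inj.
have alphaP j k : alpha v 1 j k \in Ann_l v.
  by case: (ord2P j) (ord2P k) => -> [] ->.
pose c j k := coord v k (A (tnth v 1) (tnth v j)).
have -> : A = \sum_j \sum_k c j k *: alpha v 1 j k.
  apply: lfun_basis_inj => // i; apply: lfun_basis_inj => // l.
  (* Only j = l contributes. For i = 0 both sides vanish by [A0]; for i = 1 the sum over k expands
     A(v2, v_l) in the basis. *)
  rewrite !sum_lfunE (bigD1 l) //= [X in _ + X]big1 => [|j jl].
    rewrite addr0 !sum_lfunE.
    under eq_bigr => k _ do rewrite !scale_lfunE alphaE // eqxx andbT.
    case: (ord2P i) => ->.
      by rewrite A0 zero_lfunE big1 // => k _; rewrite scale0r scaler0.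
    rewrite [LHS](coord_basis vb (memvf _)).
    by apply: eq_bigr => k _; rewrite eqxx scale1r -tnth_nth.
  rewrite !sum_lfunE big1 // => k _.
  by rewrite !scale_lfunE alphaE // (negPf jl) andbF scale0r scaler0.
by do 2!(apply: memv_suml => ? _); rewrite memvZ.
Qed.

End RightIdeals.

Theorem lemma1 (F : fieldType) (charF0 : [pchar F] =i pred0)
    (V : vectType F) (v : 2.-tuple V) (v_basis : basis_of fullv v)
    (I : {vspace 'Hom(V, 'Hom(V, V))}) :
  right_ideal v I -> nontrivial I -> (I <= Ann_l v)%VS.
Proof.
move=> Iideal [_ /eqP Inf]; apply/subvP => A AI; apply: mem_Ann_l => //.
apply: proper_right_ideal_ann Iideal Inf AI.
have /andP[_ fv] := v_basis.
by rewrite (free_not0 fv) ?mem_tnth.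
Qed.
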